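(* Let $\Lambda=\langle|\Lambda|,<\rangle$ be a linear order, let $S\subseteq|\Lambda|$, and let $\phi$ be a formula of $\mathcal{L}_S$. Then $\mathsf{GLP}_\Lambda\vdash\phi$ if and only if $\mathsf{GLP}_S\vdash\phi$.
   Context: $\Lambda$ is an arbitrary (not necessarily well-founded) linear order; its elements are called modals. The language $\mathcal{L}_\Lambda$ is built from a countably infinite set of propositional variables and the constant $\top$ using $\neg,\wedge$ and a unary modality $[\alpha]$ for each $\alpha\in|\Lambda|$; $\langle\alpha\rangle$ abbreviates $\neg[\alpha]\neg$. $\mathsf{GLP}_\Lambda$ is the logic with axioms: all substitution instances of propositional tautologies and, for all $\alpha,\beta\in|\Lambda|$ and formulas $\chi,\psi$: (i) $[\alpha](\chi\to\psi)\to([\alpha]\chi\to[\alpha]\psi)$; (ii) $[\alpha]([\alpha]\chi\to\chi)\to[\alpha]\chi$; (iii) $[\alpha]\chi\to[\beta][\alpha]\chi$ for $\alpha\le\beta$; (iv) $\langle\alpha\rangle\chi\to[\beta]\langle\alpha\rangle\chi$ for $\alpha<\beta$; (v) $[\alpha]\chi\to[\beta]\chi$ for $\alpha\le\beta$; and rules modus ponens and necessitation $\chi/[\alpha]\chi$ for each $\alpha\in|\Lambda|$. For $S\subseteq|\Lambda|$, $\mathcal{L}_S$ is the sublanguage using only modalities $[\xi]$ with $\xi\in S$, and $\mathsf{GLP}_S$ is the logic obtained by restricting all axioms and rules of $\mathsf{GLP}_\Lambda$ to formulas of $\mathcal{L}_S$ (with the order on $S$ inherited from $\Lambda$). *)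

(* Defs.v *)
From Stdlib Require Import Bool RelationClasses.

Definition strict_linear_order {A : Type} (lt : A -> A -> Prop) : Prop :=
  StrictOrder lt /\ forall a b : A, lt a b \/ a = b \/ lt b a.

Definition le_of {A : Type} (lt : A -> A -> Prop) (a b : A) : Prop :=
  lt a b \/ a = b.

Inductive form (M : Type) : Type :=
| Var : nat -> form M
| Top : form M
| Neg : form M -> form M
| And : form M -> form M -> form M
| Box : M -> form M -> form M.

Arguments Var {M} _.
Arguments Top {M}.
Arguments Neg {M} _.
Arguments And {M} _ _.
Arguments Box {M} _ _.

Definition Imp {M : Type} (p q : form M) : form M := Neg (And p (Neg q)).
Definition Dia {M : Type} (a : M) (p : form M) : form M := Neg (Box a (Neg p)).

Fixpoint lang {M : Type} (S : M -> Prop) (p : form M) : Prop :=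
  match p with
  | Var _ => True
  | Top => True
  | Neg q => lang S q
  | And q r => lang S q /\ lang S r
  | Box a q => S a /\ lang S q
  end.

Inductive pform : Type :=
| PVar : nat -> pform
| PTop : pform
| PNeg : pform -> pform
| PAnd : pform -> pform -> pform.

Fixpoint peval (v : nat -> bool) (t : pform) : bool :=
  match t with
  | PVar n => v n
  | PTop => true
  | PNeg t1 => negb (peval v t1)
  | PAnd t1 t2 => peval v t1 && peval v t2
  end.

Definition tautology (t : pform) : Prop := forall v, peval v t = true.

Fixpoint psubst {M : Type} (s : nat -> form M) (t : pform) : form M :=
  match t with
  | PVar n => s n
  | PTop => Top
  | PNeg t1 => Neg (psubst s t1)
  | PAnd t1 t2 => And (psubst s t1) (psubst s t2)
  end.

Inductive GLP_axiom {M : Type} (lt : M -> M -> Prop) : form M -> Prop :=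
| ax_taut (t : pform) (s : nat -> form M) :
    tautology t -> GLP_axiom lt (psubst s t)
| ax_K (a : M) (p q : form M) :
    GLP_axiom lt (Imp (Box a (Imp p q)) (Imp (Box a p) (Box a q)))
| ax_Loeb (a : M) (p : form M) :
    GLP_axiom lt (Imp (Box a (Imp (Box a p) p)) (Box a p))
| ax_box (a b : M) (p : form M) :
    le_of lt a b -> GLP_axiom lt (Imp (Box a p) (Box b (Box a p)))
| ax_dia (a b : M) (p : form M) :
    lt a b -> GLP_axiom lt (Imp (Dia a p) (Box b (Dia a p)))
| ax_mono (a b : M) (p : form M) :
    le_of lt a b -> GLP_axiom lt (Imp (Box a p) (Box b p)).

(* Derivations in which every formula, not only the last one, satisfies [L]. *)
Inductive GLP_within {M : Type} (lt : M -> M -> Prop) (L : form M -> Prop) :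
  form M -> Prop :=
| GLP_ax (p : form M) :
    L p -> GLP_axiom lt p -> GLP_within lt L p
| GLP_mp (p q : form M) :
    L p -> L (Imp p q) -> L q ->
    GLP_within lt L p -> GLP_within lt L (Imp p q) -> GLP_within lt L q
| GLP_nec (a : M) (p : form M) :
    L p -> L (Box a p) ->
    GLP_within lt L p -> GLP_within lt L (Box a p).

Definition GLP {M : Type} (lt : M -> M -> Prop) (p : form M) : Prop :=
  GLP_within lt (fun _ => True) p.

Definition GLP_sub {M : Type} (lt : M -> M -> Prop) (S : M -> Prop)
  (p : form M) : Prop :=
  GLP_within lt (lang S) p.

(* Main.v *)
(** If [GLP_S] does not prove [phi], a finite canonical construction gives a
    model of Beklemishev's logic J refuting [phi] in which every instance
    [[a]q -> [b]q], [a < b], with [[a]q] a subformula of [phi] holds.  The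
    modalities not occurring in [phi] have an empty relation, so this is already
    a J-model for the whole order.  It fails the other instances of
    monotonicity, but a [GLP] derivation uses only finitely many of them, say
    for [q] in [X] and modalities in [L].  Replace every plane of the model by
    [N + 1] copies, each seeing the lower ones through the corresponding
    modality, and delete, by recursion along the accessibility relations, the
    points violating one of these instances.  The result is a J-frame validating
    the derivation.  The set of [q] in [X] with [[a]q] true decreases with the
    index of the copy and stays constant once it repeats, so for [N > |X|] the
    last two copies agree; hence no point of the last copy is deleted, and
    [phi] is still refuted there. *)

From Stdlib Require Import Bool List Arith Lia Wellfounded RelationClasses.
From Stdlib Require Import Classical ClassicalEpsilon FunctionalExtensionality.
Require Import Defs.
Import ListNotations.

Definition decb (P : Prop) : bool :=
  if excluded_middle_informative P then true else false.

Lemma decbP (P : Prop) : decb P = true <-> P.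
Proof.
  unfold decb; destruct (excluded_middle_informative P); split; easy.
Qed.

(** * Subformulas *)

Fixpoint subforms {M : Type} (p : form M) : list (form M) :=
  p :: match p with
       | Var _ => []
       | Top => []
       | Neg q => subforms q
       | And q r => subforms q ++ subforms r
       | Box _ q => subforms q
       end.

Definition bodies {M : Type} (p : form M) : list (form M) :=
  flat_map (fun q => match q with Box _ r => [r] | _ => [] end) (subforms p).

Definition mods {M : Type} (p : form M) : list M :=
  flat_map (fun q => match q with Box a _ => [a] | _ => [] end) (subforms p).

Lemma subforms_refl {M : Type} (p : form M) : In p (subforms p).
Proof. destruct p; simpl; auto. Qed.

Lemma subforms_trans {M : Type} (p q : form M) :
  In q (subforms p) -> incl (subforms q) (subforms p).
Proof.
  induction p; simpl; intros [<-|H]; try apply incl_refl; try easy;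
    try (apply incl_tl; auto; fail).
  apply in_app_or in H.
  destruct H; apply incl_tl; [apply incl_appl | apply incl_appr]; auto.
Qed.

Lemma subforms_Neg {M : Type} (p q : form M) :
  In (Neg q) (subforms p) -> In q (subforms p).
Proof.
  intros H; apply (subforms_trans p _ H); simpl; right; apply subforms_refl.
Qed.

Lemma subforms_And {M : Type} (p q r : form M) :
  In (And q r) (subforms p) -> In q (subforms p) /\ In r (subforms p).
Proof.
  intros H; split; apply (subforms_trans p _ H); simpl; right;
    apply in_or_app; [left | right]; apply subforms_refl.
Qed.

Lemma subforms_Box {M : Type} (p q : form M) (a : M) :
  In (Box a q) (subforms p) -> In q (subforms p).
Proof.
  intros H; apply (subforms_trans p _ H); simpl; right; apply subforms_refl.
Qed.

Lemma in_bodies {M : Type} (p r : form M) :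
  In r (bodies p) <-> exists a, In (Box a r) (subforms p).
Proof.
  unfold bodies; rewrite in_flat_map; split.
  - intros [q [Hq Hr]]; destruct q; simpl in Hr; try easy.
    destruct Hr as [->|[]]; eauto.
  - intros [a H]; exists (Box a r); simpl; auto.
Qed.

Lemma in_mods {M : Type} (p r : form M) (a : M) :
  In (Box a r) (subforms p) -> In a (mods p).
Proof.
  intros H; unfold mods; rewrite in_flat_map.
  exists (Box a r); simpl; auto.
Qed.

Lemma bodies_subforms {M : Type} (p q : form M) :
  In q (subforms p) -> incl (bodies q) (bodies p).
Proof.
  intros H r; rewrite !in_bodies; intros [a Ha].
  exists a; apply (subforms_trans p q H); exact Ha.
Qed.

Lemma lang_subforms {M : Type} (S : M -> Prop) (p q : form M) :
  lang S p -> In q (subforms p) -> lang S q.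
Proof.
  induction p; simpl; intros Hp [<-|H]; try easy; try tauto.
  apply in_app_or in H; tauto.
Qed.

Lemma lang_bodies {M : Type} (S : M -> Prop) (p q : form M) :
  lang S p -> In q (bodies p) -> lang S q.
Proof.
  intros Hp; rewrite in_bodies; intros [a H].
  exact (proj2 (lang_subforms S p _ Hp H)).
Qed.

Lemma lang_mods {M : Type} (S : M -> Prop) (p : form M) (a : M) :
  lang S p -> In a (mods p) -> S a.
Proof.
  intros Hp; unfold mods; rewrite in_flat_map; intros [q [Hq Ha]].
  destruct q; simpl in Ha; try easy; destruct Ha as [->|[]].
  exact (proj1 (lang_subforms S p _ Hp Hq)).
Qed.

(** * Lexicographic well-foundedness over a finite set of coordinates *)

Lemma finite_min {A : Type} (lt : A -> A -> Prop) (L : list A) :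
  strict_linear_order lt -> L <> [] ->
  exists a, In a L /\ forall b, In b L -> a = b \/ lt a b.
Proof.
  intros [Hs Ht]; induction L as [|c L IH]; [easy|intros _].
  destruct L as [|d L].
  { exists c; simpl; split; auto. intros b [->|[]]; auto. }
  destruct IH as [a [Ha Hmin]]; [easy|].
  destruct (Ht c a) as [H|[->|H]].
  - exists c; split; [left; auto|]; intros b [->|Hb]; auto.
    right; destruct (Hmin b Hb) as [<-|Hb']; auto.
    transitivity a; auto.
  - exists a; split; [left; auto|]; intros b [->|Hb]; auto.
  - exists a; split; [right; auto|]; intros b [->|Hb]; auto.
Qed.

(** Lower coordinates are more significant, and those above the drop may change freely. Finiteness
    of [L] replaces well-foundedness of [lt]. *)
Definition lex {A D : Type} (lt : A -> A -> Prop) (G : A -> D -> D -> Prop)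
  (L : list A) (t s : A -> D) : Prop :=
  exists a, In a L /\ (forall b, In b L -> lt b a -> s b = t b) /\ G a (t a) (s a).

(** Induction on the size of [L]: the least coordinate is split off, with an outer induction on its
    value and an inner one on the order over the rest. *)
Lemma lex_wf {A D : Type} (lt : A -> A -> Prop) (G : A -> D -> D -> Prop)
  (L : list A) :
  strict_linear_order lt -> (forall a, well_founded (G a)) ->
  well_founded (lex lt G L).
Proof.
  intros Hlin HG.
  remember (length L) as n eqn:Hn; assert (Hle : length L <= n) by lia; clear Hn.
  revert L Hle; induction n as [|n IH]; intros L Hle.
  { destruct L; simpl in Hle; [|lia].
    intros s; constructor; intros t [a [[] _]]. }
  destruct L as [|c L0] eqn:HL.
  { intros s; constructor; intros t [a [[] _]]. }
  rewrite <- HL in *.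
  destruct (finite_min lt L Hlin) as [a0 [Ha0 Hmin]]; [now rewrite HL|].
  set (L' := filter (fun b => negb (decb (b = a0))) L).
  assert (HL' : forall b, In b L' <-> In b L /\ b <> a0).
  { intros b; unfold L'; rewrite filter_In, negb_true_iff, <- not_true_iff_false, decbP.
    tauto. }
  assert (Hlen : length L' <= n).
  { assert (length L' < length L); [|lia].
    unfold L'; clear - Ha0; induction L as [|b L IHL]; [easy|].
    simpl; destruct (decb (b = a0)) eqn:E; simpl.
    - pose proof (filter_length_le (fun b0 => negb (decb (b0 = a0))) L); lia.
    - destruct Ha0 as [->|H]; [|apply IHL in H; lia].
      rewrite (proj2 (decbP (a0 = a0)) eq_refl) in E; easy. }
  specialize (IH L' Hlen).
  assert (Key : forall d s, s a0 = d -> Acc (lex lt G L) s);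
    [|intros s; exact (Key _ s eq_refl)].
  intros d; induction (HG a0 d) as [d _ IHd].
  intros s; induction (IH s) as [s _ IHs]; intros Hs.
  constructor; intros t [a [Ha [Hlow Hdrop]]].
  destruct (classic (a = a0)) as [->|Hne].
  - apply (IHd (t a0)); congruence.
  - assert (Hlt : lt a0 a) by (destruct (Hmin a Ha); congruence).
    apply IHs.
    + exists a; split; [apply HL'; auto|]; split; auto.
      intros b Hb; apply Hlow; apply HL'; auto.
    + rewrite <- (Hlow a0); auto.
Qed.

(* A decreasing sequence of sets that, once constant for one step, stays
   constant must have become constant on a finite list [X] by step [N > |X|]. *)
Lemma stabilization {A : Type} (D : nat -> A -> Prop) (X : list A) (N : nat) :
  (forall k p, D (S k) p -> D k p) ->
  (forall k, S (S k) <= N ->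
     (forall p, In p X -> D k p -> D (S k) p) ->
     forall p, In p X -> D (S k) p -> D (S (S k)) p) ->
  length X < N ->
  forall p, In p X -> D (N - 1) p -> D N p.
Proof.
  intros Hanti Hstep Hlen.
  apply NNPP; intros Hnot.
  (* A step without loss would propagate to the last one by [Hstep], so every step below [N] loses
     an element of [X]. *)
  assert (Hprev : forall i, i < N ->
    ~ (forall p, In p X -> D (N - 1 - i) p -> D (S (N - 1 - i)) p)).
  { induction i as [|i IHi]; intros Hi H.
    - apply Hnot; intros p Hp Hd.
      replace N with (S (N - 1 - 0)) by lia; apply H; auto.
      now replace (N - 1 - 0) with (N - 1) by lia.
    - apply IHi; [lia|].
      replace (N - 1 - i) with (S (N - 1 - S i)) by lia.
      apply Hstep; [lia|]; auto. }
  assert (Hex : forall k, k < N -> exists p, In p X /\ D k p /\ ~ D (S k) p).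
  { intros k Hk; apply NNPP; intros Hno.
    apply (Hprev (N - 1 - k)); [lia|].
    replace (N - 1 - (N - 1 - k)) with k by lia.
    intros p Hp Hd; apply NNPP; intros Hd'; apply Hno; eauto. }
  (* Lost elements never return, so those picked at different steps are distinct, and [N] of them do
     not fit into [X]. *)
  assert (Hl : forall k, k <= N -> exists l, NoDup l /\ incl l X /\ length l = k /\
      forall q, In q l -> ~ D k q).
  { induction k as [|k IHk]; intros Hk.
    - exists []; repeat split; try easy; constructor.
    - destruct IHk as [l [Hnd [Hincl [Hlk Hq]]]]; [lia|].
      destruct (Hex k) as [p [Hp [Hd Hd']]]; [lia|].
      exists (p :: l); repeat split.
      + constructor; auto. intros Hin; exact (Hq p Hin Hd).
      + apply incl_cons; auto.
      + simpl; lia.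
      + intros q [<-|Hin]; auto. intros Hq'; exact (Hq q Hin (Hanti _ _ Hq')). }
  destruct (Hl N (le_n N)) as [l [Hnd [Hincl [Hlk _]]]].
  pose proof (NoDup_incl_length Hnd Hincl); lia.
Qed.

(** * Unfolding of a J-frame *)

Section Unfolding.

Variables (M : Type) (lt : M -> M -> Prop).
Hypothesis Hlin : strict_linear_order lt.

Variables (W : Type) (R : M -> W -> W -> Prop) (val : W -> nat -> Prop).
Hypothesis R_wf : forall a, well_founded (fun y x => R a x y).
Hypothesis R_trans : forall a x y z, R a x y -> R a y z -> R a x z.
Hypothesis R_low : forall a b x y z, lt a b -> R b x y -> (R a x z <-> R a y z).
Hypothesis R_mix : forall a b x y z, lt a b -> R a x y -> R b y z -> R a x z.

Variables (L : list M) (X : list (form M)) (N : nat).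

#[local] Instance lt_strict_inst : StrictOrder lt := proj1 Hlin.

Lemma lt_irrefl a : ~ lt a a.
Proof. apply (StrictOrder_Irreflexive a). Qed.

(** The plane over [a] is generated by the relations strictly above [a]; this is the part reached
    from [x] in at least one step. *)
Inductive above (a : M) (x : W) : W -> Prop :=
| above_one b y : lt a b -> R b x y -> above a x y
| above_step b z y : above a x z -> lt a b -> R b z y -> above a x y.

Lemma above_trans a x y z : above a x y -> above a y z -> above a x z.
Proof.
  intros H; induction 1.
  - eapply above_step; eauto.
  - eapply above_step; eauto.
Qed.

Lemma above_mono a b x y : lt b a -> above a x y -> above b x y.
Proof.
  intros Hba; induction 1 as [c y H|c z y H IH H'].
  - apply above_one with c; auto. transitivity a; auto.
  - apply above_step with c z; auto. transitivity a; auto.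
Qed.

(** One step above [a] keeps the [R a]-successors by [R_low], hence so does a path. *)
Lemma above_succ a x y z : above a x y -> (R a x z <-> R a y z).
Proof.
  induction 1 as [b y H HR|b w y H IH H' HR].
  - eapply R_low; eauto.
  - rewrite IH; eapply R_low; eauto.
Qed.

Lemma R_above a x y z : R a x y -> above a y z -> R a x z.
Proof.
  intros HR; induction 1 as [b z H HR'|b w z H IH H' HR'].
  - eapply R_mix; eauto.
  - eapply R_mix; [exact H'| |]; eauto.
Qed.

(* [fin] is the point of [W] being copied; [crd a] records the root of its
   plane just below the modality [a], with the index of the copy of the
   [a]-plane inside it. *)
Record point : Type := Point { crd : M -> W * nat; fin : W }.

Definition drop (a : M) (d' d : W * nat) : Prop :=
  R a (fst d) (fst d') \/ (fst d = fst d' /\ snd d' < snd d).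

(** Coordinates above [a] are left free: a step through [a] may enter any point of the plane it
    moves to, subject to [valid]. *)
Definition acc (a : M) (s t : point) : Prop :=
  In a L /\ (forall b, In b L -> lt b a -> crd s b = crd t b) /\
  drop a (crd t a) (crd s a).

(* Only the top copy, of index [N], contains the root of the plane. *)
Definition valid (s : point) : Prop :=
  forall a, In a L ->
    snd (crd s a) <= N /\
    ((snd (crd s a) = N /\ fst (crd s a) = fin s) \/ above a (fst (crd s a)) (fin s)) /\
    forall b, In b L -> lt a b ->
      fst (crd s a) = fst (crd s b) \/ above a (fst (crd s a)) (fst (crd s b)).

Definition prec (t s : point) : Prop := exists a, acc a s t.

Lemma drop_wf a : well_founded (drop a).
Proof.
  assert (H : forall x k, Acc (drop a) (x, k)); [|intros [x k]; auto].
  intros x; induction (R_wf a x) as [x _ IHx].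
  intros k; induction k as [k IHk] using lt_wf_ind.
  constructor; intros [y l] [HR|[Heq Hlt]]; simpl in *; auto.
  subst; auto.
Qed.

Lemma prec_wf : well_founded prec.
Proof.
  apply wf_incl with (fun t s => lex lt drop L (crd t) (crd s)).
  - intros t s [a [Ha [Hlow Hd]]]; exists a; auto.
  - apply (wf_inverse_image _ _ (lex lt drop L) crd).
    apply lex_wf; auto using drop_wf.
Qed.

(** * Forcing with deletion of points *)

Definition retains (P : form M -> Prop) : Prop :=
  forall a b p, In a L -> In b L -> lt a b -> In p X -> P (Box a p) -> P (Box b p).

(** Deletion and forcing form one recursion along [prec]: whether a successor is kept depends on
    what it forces, which is known by then. Deleted points are still evaluated; [Box] skips them. *)
Definition force_step (s : point)
  (rec : forall t, prec t s -> form M -> Prop) : form M -> Prop :=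
  fix go (p : form M) : Prop :=
    match p with
    | Var n => val (fin s) n
    | Top => True
    | Neg q => ~ go q
    | And q r => go q /\ go r
    | Box a q => forall t (h : acc a s t), valid t ->
        retains (rec t (ex_intro _ a h)) -> rec t (ex_intro _ a h) q
    end.

Definition force : point -> form M -> Prop :=
  Fix prec_wf (fun _ => form M -> Prop) force_step.

Definition good (t : point) : Prop := valid t /\ retains (force t).

Lemma force_eq s : force s = force_step s (fun t _ => force t).
Proof.
  unfold force; apply (Fix_eq prec_wf (fun _ => form M -> Prop)).
  intros x f g H; f_equal.
  apply functional_extensionality_dep; intros y.
  apply functional_extensionality_dep; intros p; apply H.
Qed.

Lemma force_Var s n : force s (Var n) = val (fin s) n.
Proof. rewrite force_eq; reflexivity. Qed.

Lemma force_Top s : force s Top = True.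
Proof. rewrite force_eq; reflexivity. Qed.

Lemma force_Neg s q : force s (Neg q) = ~ force s q.
Proof. rewrite !force_eq; reflexivity. Qed.

Lemma force_And s q r : force s (And q r) = (force s q /\ force s r).
Proof. rewrite !force_eq; reflexivity. Qed.

Lemma force_Box s a q :
  force s (Box a q) <-> forall t, acc a s t -> good t -> force t q.
Proof.
  rewrite force_eq; simpl; unfold good; firstorder.
Qed.

Lemma force_Imp s p q : force s (Imp p q) <-> (force s p -> force s q).
Proof.
  unfold Imp; rewrite force_Neg, force_And, force_Neg.
  destruct (classic (force s q)); tauto.
Qed.

Lemma acc_agree a s t u :
  (forall b, In b L -> le_of lt b a -> crd s b = crd t b) ->
  acc a s u -> acc a t u.
Proof.
  intros H [Ha [Hlow Hd]]; split; [|split]; auto.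
  - intros b Hb Hlt; rewrite <- H; [auto|auto|left; auto].
  - rewrite <- H; [auto|auto|right; auto].
Qed.

(** Access through [a] reads only the coordinates in [L] up to [a], so both points have the same
    [a]-successors. *)
Lemma force_Box_agree a s t p :
  (forall b, In b L -> le_of lt b a -> crd s b = crd t b) ->
  force s (Box a p) <-> force t (Box a p).
Proof.
  intros H; rewrite !force_Box; split; intros HB u Hu; apply HB;
    eapply acc_agree; try exact Hu; auto.
  intros b Hb Hle; symmetry; auto.
Qed.

Lemma acc_low a b s t : lt a b -> acc b s t ->
  forall c, In c L -> le_of lt c a -> crd s c = crd t c.
Proof.
  intros Hab [_ [H _]] c Hc [Hca| ->]; apply H; auto.
  transitivity a; auto.
Qed.

(** If [lt a b], the second step keeps every coordinate up to [a]; if [a = b], two drops compose. *)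
Lemma acc_trans a b s t u :
  le_of lt a b -> acc a s t -> acc b t u -> acc a s u.
Proof.
  intros Hab [Ha [Hlow Hd]] [Hb [Hlow' Hd']]; split; auto.
  destruct Hab as [Hab| <-].
  - split.
    + intros c Hc Hca; rewrite Hlow; auto.
      apply Hlow'; auto. transitivity a; auto.
    + rewrite <- Hlow'; auto.
  - split.
    + intros c Hc Hca; rewrite Hlow; auto.
    + destruct Hd as [Hd|[Hd Hk]], Hd' as [Hd'|[Hd' Hk']].
      * left; eauto.
      * left; congruence.
      * left; rewrite Hd; auto.
      * right; split; [congruence|lia].
Qed.

Lemma force_psubst s sigma t :
  force s (psubst sigma t) <-> peval (fun n => decb (force s (sigma n))) t = true.
Proof.
  induction t as [n| |t IH|t1 IH1 t2 IH2]; simpl.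
  - now rewrite decbP.
  - now rewrite force_Top.
  - rewrite force_Neg, IH, negb_true_iff, not_true_iff_false; tauto.
  - rewrite force_And, IH1, IH2, andb_true_iff; tauto.
Qed.

(** ** Copies of a plane *)

(** The counterpart of [s] in copy [k] of its plane over [j]; the coordinates above [j] locate it
    inside the plane. *)
Definition upd (s : point) (j : M) (k : nat) : point :=
  Point (fun m => if decb (m = j) then (fst (crd s j), k) else crd s m) (fin s).

Lemma upd_same s j k : crd (upd s j k) j = (fst (crd s j), k).
Proof. simpl; now rewrite (proj2 (decbP (j = j)) eq_refl). Qed.

Lemma upd_other s j k m : m <> j -> crd (upd s j k) m = crd s m.
Proof.
  intros H; simpl; destruct (decb (m = j)) eqn:E; auto.
  rewrite decbP in E; easy.
Qed.

Lemma upd_fst s j k m : fst (crd (upd s j k) m) = fst (crd s m).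
Proof.
  destruct (classic (m = j)) as [->|H]; [now rewrite upd_same|now rewrite upd_other].
Qed.

Lemma point_eq s t : (forall m, crd s m = crd t m) -> fin s = fin t -> s = t.
Proof.
  destruct s as [c x], t as [d y]; simpl; intros H ->; f_equal.
  apply functional_extensionality; auto.
Qed.

Lemma upd_upd s j k k' : upd (upd s j k) j k' = upd s j k'.
Proof.
  apply point_eq; auto; intros m.
  destruct (classic (m = j)) as [->|H].
  - rewrite !upd_same; auto.
  - rewrite !upd_other; auto.
Qed.

Lemma upd_id s j k : snd (crd s j) = k -> upd s j k = s.
Proof.
  intros H; apply point_eq; auto; intros m.
  destruct (classic (m = j)) as [->|Hm].
  - rewrite upd_same, <- H; now destruct (crd s j).
  - rewrite upd_other; auto.
Qed.

Lemma upd_valid s j k :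
  valid s -> k <= N -> above j (fst (crd s j)) (fin s) -> valid (upd s j k).
Proof.
  intros Hs Hk Hab a Ha; destruct (Hs a Ha) as [H1 [H2 H3]].
  split; [|split].
  - destruct (classic (a = j)) as [->|H]; [now rewrite upd_same|now rewrite upd_other].
  - destruct (classic (a = j)) as [->|H]; [rewrite upd_same; now right|now rewrite upd_other].
  - intros b Hb Hlt; rewrite !upd_fst; auto.
Qed.

Lemma upd_agree s t j k m :
  In j L -> lt j m ->
  (forall b, In b L -> lt b m -> crd s b = crd t b) ->
  forall b, In b L -> lt b m -> crd (upd s j k) b = crd (upd t j k) b.
Proof.
  intros Hj Hjm H b Hb Hbm.
  destruct (classic (b = j)) as [->|Hne].
  - rewrite !upd_same, H; auto.
  - rewrite !upd_other; auto.
Qed.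

Lemma acc_upd m s t j k :
  In j L -> lt j m -> acc m s t -> acc m (upd s j k) (upd t j k).
Proof.
  intros Hj Hjm [Hm [Hlow Hd]]; split; [|split]; auto.
  - eapply upd_agree; eauto.
  - rewrite !upd_other; auto; intros ->; exact (lt_irrefl _ Hjm).
Qed.

(* A point strictly inside the [j]-copy is never the root of that copy. *)
Lemma acc_above m s t j :
  In j L -> lt j m -> valid s -> valid t -> acc m s t ->
  above j (fst (crd s j)) (fin t).
Proof.
  intros Hj Hjm Hs Ht [Hm [Hlow Hd]].
  destruct (Hs j Hj) as [_ [_ Hsj]]; specialize (Hsj m Hm Hjm).
  destruct (Ht m Hm) as [_ [Htm _]].
  assert (H : above j (fst (crd s m)) (fin t)).
  { destruct Hd as [HR|[He Hl]].
    - assert (H : above j (fst (crd s m)) (fst (crd t m))) by (eapply above_one; eauto).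
      destruct Htm as [[_ <-]|Htm]; auto.
      eapply above_trans; eauto using above_mono.
    (* The index at [m] has dropped below [N], so [t] cannot be the root of its copy. *)
    - destruct (Hs m Hm) as [Hle _].
      destruct Htm as [[Heq _]|Htm]; [lia|].
      rewrite He; eauto using above_mono. }
  destruct Hsj as [->|Hsj]; auto.
  eapply above_trans; eauto.
Qed.

Definition closed_in (p : form M) : Prop := incl (bodies p) X.

Hypothesis X_closed : forall p, In p X -> closed_in p.

Lemma closed_in_Box a p : In p X -> closed_in (Box a p).
Proof.
  intros Hp r; rewrite in_bodies; intros [b [H|H]].
  - injection H as -> ->; auto.
  - apply (X_closed p Hp); rewrite in_bodies; eauto.
Qed.

(** By [force_Box_agree] this is a property of the whole plane over [j], independent of the position
    of [s] in it. *)
Definition stable (j : M) (s : point) (k k' : nat) : Prop :=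
  forall p, In p X ->
    (force (upd s j k) (Box j p) <-> force (upd s j k') (Box j p)).

(** Only formulas [Box a p] with [p] in [X] are inspected, so agreement on closed formulas transfers
    deletion as well. *)
Lemma retains_iff (P Q : form M -> Prop) :
  (forall p, closed_in p -> (P p <-> Q p)) -> retains P <-> retains Q.
Proof.
  intros H; split; intros HP a b p Ha Hb Hab Hp Hbox.
  - apply H; [now apply closed_in_Box|].
    apply HP with a; auto. apply H; [now apply closed_in_Box|auto].
  - apply H; [now apply closed_in_Box|].
    apply HP with a; auto. apply H; [now apply closed_in_Box|auto].
Qed.

Lemma stable_agree j m s t k k' :
  In j L -> lt j m -> (forall b, In b L -> lt b m -> crd s b = crd t b) ->
  stable j s k k' -> stable j t k k'.
Proof.
  intros Hj Hjm H Hst p Hp.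
  rewrite <- (force_Box_agree j (upd s j k) (upd t j k)).
  - rewrite <- (force_Box_agree j (upd s j k') (upd t j k')); auto.
    intros b Hb Hle; eapply upd_agree; eauto.
    destruct Hle as [Hle| ->]; auto. transitivity j; auto.
  - intros b Hb Hle; eapply upd_agree; eauto.
    destruct Hle as [Hle| ->]; auto. transitivity j; auto.
Qed.

(** Induction along [prec], then on the formula. Boxes below [j] ignore the index, boxes at [j]
    agree by stability, and for boxes above [j] the map [upd] matches the successors on both sides,
    deletions included. *)
Lemma stable_force j s k k' :
  In j L -> k <= N -> k' <= N -> valid s -> snd (crd s j) = k ->
  above j (fst (crd s j)) (fin s) -> stable j s k k' ->
  forall p, closed_in p -> (force s p <-> force (upd s j k') p).
Proof.
  intros Hj Hk Hk'; induction (prec_wf s) as [s _ IH]; intros Hs Hsk Hab Hst.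
  induction p as [n| |q IHq|q IHq r IHr|m q _]; intros Hp.
  - now rewrite !force_Var.
  - now rewrite !force_Top.
  - rewrite !force_Neg, IHq; [tauto|].
    intros x Hx; apply Hp; revert x Hx; apply bodies_subforms.
    apply subforms_Neg, subforms_refl.
  - assert (Hqr : closed_in q /\ closed_in r).
    { destruct (subforms_And _ q r (subforms_refl _)).
      split; intros x Hx; apply Hp; revert x Hx; apply bodies_subforms; auto. }
    rewrite !force_And, IHq, IHr; tauto.
  - destruct (proj2 Hlin m j) as [Hmj|[->|Hjm]].
    + apply force_Box_agree; intros b Hb Hle; rewrite upd_other; auto.
      intros ->; apply (lt_irrefl j).
      destruct Hle as [Hle| ->]; auto. transitivity m; auto.
    + rewrite <- (upd_id s j k Hsk) at 1; apply Hst.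
      apply Hp; rewrite in_bodies; exists j; apply subforms_refl.
    + assert (Hq : closed_in q).
      { intros x Hx; apply Hp; revert x Hx; apply bodies_subforms.
        eapply subforms_Box, subforms_refl. }
      assert (Hiso : forall v, acc m s v -> valid v ->
                forall p, closed_in p -> (force v p <-> force (upd v j k') p)).
      { intros v Hv Hval.
        assert (Hvj : crd s j = crd v j) by (apply Hv; auto).
        apply IH; auto.
        - now exists m.
        - now rewrite <- Hvj.
        - rewrite <- Hvj; apply (acc_above m); auto.
        - apply (stable_agree j m s); auto; apply Hv. }
      rewrite !force_Box; split; intros HB v Hv [Hval Hret].
      (* [v] lies in copy [k']; its counterpart in copy [k] is a successor of [s], where the
         induction hypothesis applies. *)
      * set (v0 := upd v j k).
        assert (Hv0 : acc m s v0).
        { rewrite <- (upd_id s j k Hsk), <- (upd_upd s j k' k).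
          now apply acc_upd. }
        assert (Hj' : fst (crd v j) = fst (crd s j)).
        { rewrite <- (upd_fst s j k' j); f_equal; symmetry; apply Hv; auto. }
        assert (Hval0 : valid v0).
        { apply upd_valid; auto. rewrite Hj'.
          rewrite <- (upd_fst s j k' j); apply (acc_above m); auto.
          apply upd_valid; auto. }
        assert (Hback : upd v0 j k' = v).
        { unfold v0; rewrite upd_upd; apply upd_id.
          replace (crd v j) with (crd (upd s j k') j) by (apply Hv; auto).
          now rewrite upd_same. }
        rewrite <- Hback; apply (proj1 (Hiso v0 Hv0 Hval0 q Hq)).
        apply HB; auto; split; auto.
        apply (retains_iff _ (force (upd v0 j k')) (Hiso v0 Hv0 Hval0)).
        now rewrite Hback.
      * apply (Hiso v Hv Hval q Hq).
        apply HB; [now apply acc_upd|split].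
        -- apply upd_valid; auto. replace (crd v j) with (crd s j) by (apply Hv; auto).
           apply (acc_above m); auto.
        -- now apply (retains_iff _ _ (Hiso v Hv Hval)).
Qed.

Lemma stable_good j s k k' :
  In j L -> k <= N -> k' <= N -> good s -> snd (crd s j) = k ->
  above j (fst (crd s j)) (fin s) -> stable j s k k' -> good (upd s j k').
Proof.
  intros Hj Hk Hk' [Hs Hret] Hsk Hab Hst; split; [now apply upd_valid|].
  apply (retains_iff (force s) (force (upd s j k'))); auto.
  apply (stable_force j s k k'); auto.
Qed.

Lemma acc_upd_self j s k v :
  acc j (upd s j k) v <->
  In j L /\ (forall b, In b L -> lt b j -> crd s b = crd v b) /\
  drop j (crd v j) (fst (crd s j), k).
Proof.
  unfold acc; rewrite upd_same.
  assert (H : forall b, lt b j -> crd (upd s j k) b = crd s b).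
  { intros b Hb; apply upd_other; intros ->; exact (lt_irrefl _ Hb). }
  split; intros [H1 [H2 H3]]; split; auto; split; auto; intros b Hb Hlt;
    specialize (H2 b Hb Hlt); rewrite H in *; auto.
Qed.

(** A higher copy sees at least the points seen by a lower one. *)
Lemma level_antitone j s k p :
  force (upd s j (S k)) (Box j p) -> force (upd s j k) (Box j p).
Proof.
  rewrite !force_Box; intros H v Hv; apply H.
  rewrite acc_upd_self in *; destruct Hv as [H1 [H2 H3]]; split; auto; split; auto.
  destruct H3 as [H3|[H3 H4]]; simpl in *; [now left|right; simpl; split; auto].
Qed.

(** Copy [k + 2] sees, beyond what copy [k + 1] sees, only points of copy [k + 1]. Their
    counterparts in copy [k] satisfy the same formulas and are seen from copy [k + 1]. *)
Lemma level_step j s k :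
  S (S k) <= N ->
  (forall p, In p X -> force (upd s j k) (Box j p) -> force (upd s j (S k)) (Box j p)) ->
  forall p, In p X -> force (upd s j (S k)) (Box j p) ->
    force (upd s j (S (S k))) (Box j p).
Proof.
  intros Hk Hst p Hp; rewrite !force_Box; intros H v Hv [Hval Hret].
  rewrite acc_upd_self in Hv; destruct Hv as [Hj [Hlow Hd]].
  destruct (classic (drop j (crd v j) (fst (crd s j), S k))) as [Hd'|Hd'].
  { apply H; [|now split]. rewrite acc_upd_self; auto. }
  assert (Hfst : fst (crd v j) = fst (crd s j) /\ snd (crd v j) = S k).
  { destruct Hd as [Hd|[Hd Hl]]; simpl in *.
    - exfalso; apply Hd'; now left.
    - split; auto.
      apply NNPP; intros Hne; apply Hd'; right; simpl; split; [auto|lia]. }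
  destruct Hfst as [Hfst Hsnd].
  (* The index [S k] is below [N], so [v] is not a root and has a counterpart in copy [k]. *)
  assert (Hab : above j (fst (crd v j)) (fin v)).
  { destruct (Hval j Hj) as [_ [[[He _]|Hab] _]]; [lia|auto]. }
  assert (Hstv : stable j v (S k) k).
  { assert (Hag : forall l b, In b L -> le_of lt b j ->
                    crd (upd v j l) b = crd (upd s j l) b).
    { intros l b Hb Hle; destruct (classic (b = j)) as [->|Hne].
      - rewrite !upd_same, Hfst; auto.
      - rewrite !upd_other; auto; symmetry; apply Hlow; auto.
        destruct Hle; easy. }
    intros q Hq; rewrite (force_Box_agree j _ _ q (Hag (S k))).
    rewrite (force_Box_agree j _ _ q (Hag k)).
    split; [apply level_antitone|auto]. }
  apply (stable_force j v (S k) k); auto; try lia.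
  apply H.
  - rewrite acc_upd_self; split; auto; split.
    + intros b Hb Hlt; rewrite upd_other; auto.
      intros ->; exact (lt_irrefl _ Hlt).
    + rewrite upd_same; right; simpl; auto.
  - apply (stable_good j v (S k) k); auto; try lia; now split.
Qed.

Hypothesis X_small : length X < N.

(** [stabilization] applies to the sets of [p] in [X] with [Box j p] true in the successive
    copies. *)
Lemma top_stable j s : stable j s N (N - 1).
Proof.
  intros p Hp; split.
  - replace N with (S (N - 1)) at 1 by lia; apply level_antitone.
  - apply (stabilization (fun k p => force (upd s j k) (Box j p)) X N); auto.
    + intros k q; apply level_antitone.
    + apply level_step.
Qed.

(* The [N]-th copy sees the [N-1]-st copy, and the two satisfy the same
   formulas of [X] at every point other than the root. *)
Lemma fresh_retains j j' t p :
  valid t -> In j L -> In j' L -> lt j j' -> crd t j = (fin t, N) -> In p X ->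
  force t (Box j p) -> force t (Box j' p).
Proof.
  intros Ht Hj Hj' Hlt Htj Hp; rewrite !force_Box; intros HB u Hu [Hval Hret].
  assert (Huj : crd u j = (fin t, N)) by (rewrite <- Htj; symmetry; apply Hu; auto).
  assert (Hab : above j (fst (crd u j)) (fin u)).
  { replace (crd u j) with (crd t j) by (apply Hu; auto).
    apply (acc_above j'); auto. }
  assert (Hsnd : snd (crd u j) = N) by now rewrite Huj.
  apply (stable_force j u N (N - 1)); auto using top_stable; try lia.
  apply HB.
  - split; auto; split.
    + intros b Hb Hbj; rewrite upd_other.
      * apply Hu; auto. transitivity j; auto.
      * intros ->; exact (lt_irrefl _ Hbj).
    + rewrite upd_same, Huj, Htj; right; simpl; split; [auto|lia].
  - apply (stable_good j u N (N - 1)); auto using top_stable; try lia; now split.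
Qed.

Lemma root_good x : good (Point (fun _ => (x, N)) x).
Proof.
  assert (Hv : valid (Point (fun _ => (x, N)) x)).
  { intros a Ha; simpl; auto. }
  split; auto.
  intros a b p Ha Hb Hab Hp; now apply fresh_retains.
Qed.

Lemma fst_crd_succ s i y :
  valid s -> In i L -> (R i (fst (crd s i)) y <-> R i (fin s) y).
Proof.
  intros Hs Hi; destruct (Hs i Hi) as [_ [[[_ ->]|H] _]]; [tauto|].
  now apply above_succ.
Qed.

(** The witness keeps the coordinates below [i] and opens top copies rooted at [y] from [i] on.
    Monotonicity below [i] is inherited from [s], and from [i] on it comes from [fresh_retains]. *)
Lemma child_good s i y :
  good s -> In i L -> R i (fin s) y -> exists t, acc i s t /\ good t /\ fin t = y.
Proof.
  intros [Hs Hret] Hi HR.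
  set (t := Point (fun m => if decb (lt m i) then crd s m else (y, N)) y).
  assert (Hlow : forall m, lt m i -> crd t m = crd s m).
  { intros m Hm; simpl; now rewrite (proj2 (decbP (lt m i)) Hm). }
  assert (Hhigh : forall m, ~ lt m i -> crd t m = (y, N)).
  { intros m Hm; simpl; destruct (decb (lt m i)) eqn:E; auto.
    rewrite decbP in E; easy. }
  assert (Hacc : acc i s t).
  { split; auto; split.
    - intros b _ Hb; now rewrite Hlow.
    - rewrite Hhigh; [|apply lt_irrefl]. left; simpl; now apply fst_crd_succ. }
  assert (Hab : forall m, In m L -> lt m i -> above m (fst (crd s m)) y).
  { intros m Hm Hmi; destruct (Hs m Hm) as [_ [[[_ ->]|H] _]].
    - eapply above_one; eauto.
    - eapply above_step; eauto. }
  assert (Ht : valid t).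
  { intros a Ha; destruct (classic (lt a i)) as [Hai|Hai].
    - rewrite (Hlow a Hai); destruct (Hs a Ha) as [H1 [H2 H3]].
      split; auto; split; [right; now apply Hab|].
      intros b Hb Hlt; destruct (classic (lt b i)) as [Hbi|Hbi].
      + rewrite Hlow; auto.
      + rewrite Hhigh; auto.
    - rewrite (Hhigh a Hai); simpl; split; auto; split; auto.
      intros b Hb Hlt; left.
      assert (Hb' : ~ lt b i) by (intros Hbi; apply Hai; transitivity b; auto).
      destruct (decb (lt b i)) eqn:E; auto; rewrite decbP in E; easy. }
  exists t; split; auto; split; auto; split; auto.
  intros a b p Ha Hb Hlt Hp Hbox.
  destruct (classic (lt a i)) as [Hai|Hai].
  - assert (Hsa : force s (Box a p)).
    { apply (force_Box_agree a s t); auto; apply (acc_low a i); auto. }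
    destruct (classic (lt b i)) as [Hbi|Hbi].
    + apply (force_Box_agree b s t); [apply (acc_low b i); auto|].
      apply Hret with a; auto.
    (* Here [a] is below [i] and [b] is not: [Box i p] at [s] covers the [b]-successors of [t] by
       transitivity. *)
    + assert (Hsi : force s (Box i p)) by (apply Hret with a; auto).
      rewrite force_Box in *; intros u Hu; apply Hsi.
      apply (acc_trans i b s t); auto.
      destruct (proj2 Hlin i b) as [H|[H|H]]; [now left|now right|easy].
  - apply (fresh_retains a b t p); auto.
Qed.

(** ** Truth is preserved *)

Variables (phi : form M) (lab : W -> form M -> Prop).
Hypothesis lab_Var : forall x n, lab x (Var n) <-> val x n.
Hypothesis lab_Top : forall x, In Top (subforms phi) -> lab x Top.
Hypothesis lab_Neg : forall x q, In (Neg q) (subforms phi) ->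
  (lab x (Neg q) <-> ~ lab x q).
Hypothesis lab_And : forall x q r, In (And q r) (subforms phi) ->
  (lab x (And q r) <-> lab x q /\ lab x r).
Hypothesis lab_Box : forall x a q, In (Box a q) (subforms phi) ->
  (lab x (Box a q) <-> forall y, R a x y -> lab y q).
Hypothesis lab_mono : forall x y a b q, In (Box a q) (subforms phi) ->
  lt a b -> lab x (Box a q) -> R b x y -> lab y q.
Hypothesis mods_L : incl (mods phi) L.

(** [Box a q] persists along the path because the [R a]-successors do, and [lab_mono] makes the
    final step. *)
Lemma lab_above a x y q :
  In (Box a q) (subforms phi) -> lab x (Box a q) -> above a x y -> lab y q.
Proof.
  intros Hq Hx; induction 1 as [b y Hb HR|b z y Hz _ Hb HR].
  - eapply lab_mono; eauto.
  - apply (lab_mono z y a b); auto.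
    rewrite lab_Box in *; auto; intros w Hw; apply Hx.
    now apply (above_succ a x z w).
Qed.

(** For boxes, [child_good] lifts successors in one direction. Conversely, a step ends in the plane
    of an [R a]-successor of the root, or in a lower copy strictly inside the same plane; [R_above]
    and [lab_above] settle these. *)
Lemma force_lab p :
  In p (subforms phi) -> forall s, good s -> (force s p <-> lab (fin s) p).
Proof.
  induction p as [n| |q IHq|q IHq r IHr|a q IHq]; intros Hp s Hs.
  - now rewrite force_Var, lab_Var.
  - rewrite force_Top; split; auto.
  - rewrite force_Neg, lab_Neg, IHq; auto using subforms_Neg; tauto.
  - destruct (subforms_And phi q r Hp).
    rewrite force_And, lab_And, IHq, IHr; auto; tauto.
  - pose proof (subforms_Box phi q a Hp) as Hq; specialize (IHq Hq).
    assert (Ha : In a L) by (apply mods_L; eapply in_mods; eauto).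
    split.
    + rewrite force_Box, lab_Box; auto; intros HB y HR.
      destruct (child_good s a y Hs Ha HR) as [t [Hacc [Ht <-]]].
      apply IHq; auto.
    + intros Hx; rewrite force_Box; intros t [_ [Hlow Hd]] Ht.
      apply IHq; auto.
      (* [drop] is measured at the root of the plane, so [Box a q] is first moved there. *)
      assert (Hroot : lab (fst (crd s a)) (Box a q)).
      { rewrite lab_Box in *; auto; intros y Hy; apply Hx.
        apply fst_crd_succ; auto; apply Hs. }
      destruct (proj1 Ht a Ha) as [_ [Hta _]].
      destruct Hd as [HR|[Heq Hlt]].
      * rewrite lab_Box in Hroot; auto; apply Hroot.
        destruct Hta as [[_ <-]|Hta]; auto.
        eapply R_above; eauto.
      * destruct (proj1 Hs a Ha) as [Hle _].
        destruct Hta as [[HN _]|Hta]; [lia|].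
        apply (lab_above a (fst (crd s a))); auto. now rewrite Heq.
Qed.

End Unfolding.

(** * Soundness of GLP in the unfolding *)

Lemma incl_app_l {A : Type} (l m n : list A) : incl (l ++ m) n -> incl l n.
Proof. intros H x Hx; apply H, in_or_app; auto. Qed.

Lemma incl_app_r {A : Type} (l m n : list A) : incl (l ++ m) n -> incl m n.
Proof. intros H x Hx; apply H, in_or_app; auto. Qed.

(* [L] and [X] only have to contain the finitely many instances of monotonicity
   used in the derivation. *)
Lemma GLP_sound (M : Type) (lt : M -> M -> Prop) (Hlin : strict_linear_order lt)
  (W : Type) (R : M -> W -> W -> Prop) (val : W -> nat -> Prop)
  (R_wf : forall a, well_founded (fun y x => R a x y))
  (R_trans : forall a x y z, R a x y -> R a y z -> R a x z)
  (p : form M) :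
  GLP lt p ->
  exists (L0 : list M) (X0 : list (form M)), forall L X N,
    incl L0 L -> incl X0 X ->
    forall s, good M lt Hlin W R val R_wf L X N s ->
      force M lt Hlin W R val R_wf L X N s p.
Proof.
  induction 1 as [p _ Hax|p q _ _ _ _ IHp _ IHpq|a p _ _ _ IH].
  - destruct Hax as [t sigma Ht|a p q|a p|a b p Hab|a b p Hab|a b p Hab].
    + exists [], []; intros L X N _ _ s _; apply force_psubst; apply Ht.
    + exists [], []; intros L X N _ _ s _; rewrite !force_Imp, !force_Box.
      intros H1 H2 t Ht Hg; specialize (H1 t Ht Hg).
      rewrite force_Imp in H1; auto.
    + exists [], []; intros L X N _ _ s _; rewrite force_Imp, !force_Box.
      intros H t Ht Hg.
      (* Loeb's axiom follows by induction along [prec], which contains access through [a]. *)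
      assert (Hind : forall u,
                acc M lt W R L a s u -> good M lt Hlin W R val R_wf L X N u ->
                force M lt Hlin W R val R_wf L X N u p).
      { intros u; induction (prec_wf M lt Hlin W R R_wf L u) as [u _ IHu].
        intros Hu Hgu; specialize (H u Hu Hgu); rewrite force_Imp in H; apply H.
        rewrite force_Box; intros v Hv Hgv; apply IHu; auto.
        - now exists a.
        - eapply acc_trans; eauto. now right. }
      auto.
    + exists [], []; intros L X N _ _ s _; rewrite force_Imp, !force_Box.
      intros H t Ht Hg; rewrite force_Box; intros u Hu; apply H.
      destruct Hab as [Hab| <-].
      * eapply acc_agree; [|exact Hu].
        intros c Hc Hle; symmetry; eapply acc_low; eauto.
      * eapply acc_trans; eauto. now right.
    + exists [], []; intros L X N _ _ s _; rewrite force_Imp, force_Box.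
      unfold Dia; intros H t Ht Hg; rewrite force_Neg in *.
      rewrite <- (force_Box_agree M lt Hlin W R val R_wf L X N a s t); auto.
      eapply acc_low; eauto.
    (* The one axiom that puts demands on [L] and [X]: [retains] supplies the instance at points
       that survive. *)
    + exists [a; b], [p]; intros L X N HL HX s [_ Hret]; rewrite force_Imp.
      destruct Hab as [Hab| ->]; auto.
      apply Hret; auto.
      * apply HL; simpl; auto.
      * apply HL; simpl; auto.
      * apply HX; simpl; auto.
  - destruct IHp as [L1 [X1 H1]], IHpq as [L2 [X2 H2]].
    exists (L1 ++ L2), (X1 ++ X2); intros L X N HL HX s Hs.
    specialize (H1 L X N (incl_app_l _ _ _ HL) (incl_app_l _ _ _ HX) s Hs).
    specialize (H2 L X N (incl_app_r _ _ _ HL) (incl_app_r _ _ _ HX) s Hs).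
    rewrite force_Imp in H2; auto.
  - destruct IH as [L0 [X0 H0]].
    exists L0, X0; intros L X N HL HX s Hs; rewrite force_Box; eauto.
Qed.

(** * Finite J-models from unprovability *)

Section Canonical.

Variables (M : Type) (lt : M -> M -> Prop).
Hypothesis Hlin : strict_linear_order lt.
Variable S : M -> Prop.

Notation Prov := (GLP_within lt (lang S)).

(** * Propositional and modal reasoning within the sublanguage *)

Fixpoint bval (v : form M -> bool) (p : form M) : bool :=
  match p with
  | Top => true
  | Neg q => negb (bval v q)
  | And q r => bval v q && bval v r
  | Var _ | Box _ _ => v p
  end.

Fixpoint index (l : list (form M)) (p : form M) : nat :=
  match l with
  | [] => 0
  | q :: l' => if decb (p = q) then 0 else Datatypes.S (index l' p)
  end.

Lemma nth_index l p : In p l -> nth (index l p) l Top = p.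
Proof.
  induction l as [|q l IH]; [easy|]; simpl; intros H.
  destruct (decb (p = q)) eqn:E.
  - now rewrite decbP in E.
  - apply IH; destruct H as [->|H]; auto.
    exfalso; rewrite <- not_true_iff_false, decbP in E; auto.
Qed.

Fixpoint skeleton (l : list (form M)) (p : form M) : pform :=
  match p with
  | Top => PTop
  | Neg q => PNeg (skeleton l q)
  | And q r => PAnd (skeleton l q) (skeleton l r)
  | Var _ | Box _ _ => PVar (index l p)
  end.

(** Every atom of [p] occurs in [l], so the default [Top] of [nth] is never reached. *)
Lemma psubst_skeleton l p :
  incl (subforms p) l -> psubst (fun n => nth n l Top) (skeleton l p) = p.
Proof.
  induction p as [n| |q IHq|q IHq r IHr|a q _]; intros H.
  - apply (nth_index l (Var n)), H, subforms_refl.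
  - reflexivity.
  - simpl; rewrite IHq; auto. intros x Hx; apply H; simpl; auto.
  - simpl; rewrite IHq, IHr; auto;
      intros x Hx; apply H; simpl; right; apply in_or_app; auto.
  - apply (nth_index l (Box a q)), H, subforms_refl.
Qed.

Lemma peval_skeleton l v p :
  peval v (skeleton l p) = bval (fun q => v (index l q)) p.
Proof. induction p; simpl; congruence. Qed.

Lemma prov_lang p : Prov p -> lang S p.
Proof. now destruct 1. Qed.

Lemma prov_taut p : lang S p -> (forall v, bval v p = true) -> Prov p.
Proof.
  intros Hp H; apply GLP_ax; auto.
  rewrite <- (psubst_skeleton (subforms p) p (incl_refl _)).
  constructor; intros v; rewrite peval_skeleton; apply H.
Qed.

Lemma bval_Imp v p q : bval v (Imp p q) = implb (bval v p) (bval v q).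
Proof. simpl; now destruct (bval v p), (bval v q). Qed.

Lemma prov_cons p q :
  lang S q -> Prov p -> (forall v, bval v p = true -> bval v q = true) -> Prov q.
Proof.
  intros Hq Hp H; pose proof (prov_lang p Hp).
  apply GLP_mp with p; auto; [simpl; tauto|].
  apply prov_taut; [simpl; tauto|].
  intros v; rewrite bval_Imp; specialize (H v).
  destruct (bval v p); simpl; auto.
Qed.

Lemma prov_cons2 p1 p2 q :
  lang S q -> Prov p1 -> Prov p2 ->
  (forall v, bval v p1 = true -> bval v p2 = true -> bval v q = true) -> Prov q.
Proof.
  intros Hq H1 H2 H; pose proof (prov_lang p1 H1).
  apply GLP_mp with p1; auto; [simpl; tauto|].
  apply prov_cons with p2; auto; [simpl; tauto|].
  intros v Hv; rewrite bval_Imp; specialize (H v).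
  destruct (bval v p1); simpl; auto.
Qed.

Lemma prov_trans p q r : Prov (Imp p q) -> Prov (Imp q r) -> Prov (Imp p r).
Proof.
  intros H1 H2; pose proof (prov_lang _ H1); pose proof (prov_lang _ H2).
  apply (prov_cons2 _ _ _) with (2 := H1) (3 := H2); [simpl in *; tauto|].
  intros v; rewrite !bval_Imp; destruct (bval v p), (bval v q); simpl; auto; discriminate.
Qed.

Lemma prov_Box_mono a p q :
  S a -> Prov (Imp p q) -> Prov (Imp (Box a p) (Box a q)).
Proof.
  intros Ha H; pose proof (prov_lang _ H).
  apply GLP_mp with (Box a (Imp p q)); try (simpl in *; tauto).
  - apply GLP_nec; simpl in *; tauto.
  - apply GLP_ax; [simpl in *; tauto|constructor].
Qed.

Fixpoint conj (l : list (form M)) : form M :=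
  match l with [] => Top | p :: l' => And p (conj l') end.

Lemma lang_conj l : (forall p, In p l -> lang S p) -> lang S (conj l).
Proof. induction l; simpl; auto. Qed.

Lemma bval_conj v l : bval v (conj l) = true <-> forall p, In p l -> bval v p = true.
Proof.
  induction l as [|q l IH]; simpl; [easy|].
  rewrite andb_true_iff, IH; split.
  - intros [H1 H2] p [<-|H]; auto.
  - auto.
Qed.

Lemma prov_conj c l :
  lang S c -> (forall p, In p l -> Prov (Imp c p)) -> Prov (Imp c (conj l)).
Proof.
  intros Hc; induction l as [|p l IH]; intros H.
  - apply prov_taut; [simpl; auto|]. intros v; rewrite bval_Imp; simpl; apply implb_true_r.
  - assert (H1 : Prov (Imp c p)) by (apply H; simpl; auto).
    assert (H2 : Prov (Imp c (conj l))) by (apply IH; intros; apply H; simpl; auto).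
    pose proof (prov_lang _ H1); pose proof (prov_lang _ H2).
    apply (prov_cons2 _ _ _) with (2 := H1) (3 := H2); [simpl in *; tauto|].
    intros v; rewrite !bval_Imp; simpl; destruct (bval v c); simpl; auto.
    intros -> ->; auto.
Qed.

Lemma prov_Box_conj a l p :
  S a -> Prov (Imp (conj l) p) -> Prov (Imp (conj (map (Box a) l)) (Box a p)).
Proof.
  intros Ha; revert p; induction l as [|q l IH]; intros p H;
    pose proof (prov_lang _ H) as HL.
  - simpl in HL; assert (Hp : Prov p).
    { apply (prov_cons _ _) with (2 := H); [tauto|].
      intros v; rewrite bval_Imp; auto. }
    apply (prov_cons (Box a p)); [simpl; tauto| |].
    + apply GLP_nec; simpl; tauto.
    + intros v Hv; rewrite bval_Imp, Hv; apply implb_true_r.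
  - assert (H' : Prov (Imp (conj l) (Imp q p))).
    { apply (prov_cons _ _) with (2 := H); [simpl in *; tauto|].
      intros v; rewrite !bval_Imp; simpl.
      destruct (bval v q), (bval v (conj l)); simpl; auto. }
    apply IH in H'; pose proof (prov_lang _ H').
    assert (HK : Prov (Imp (Box a (Imp q p)) (Imp (Box a q) (Box a p)))).
    { apply GLP_ax; [simpl in *; tauto|constructor]. }
    pose proof (prov_lang _ HK).
    apply (prov_cons2 _ _ _) with (2 := H') (3 := HK); [simpl in *; tauto|].
    intros v; rewrite !bval_Imp; simpl.
    destruct (v (Box a q)), (v (Box a p)), (bval v (conj (map (Box a) l)));
      simpl; auto; intros ->; auto.
Qed.

Lemma prov_mono a b p :
  S a -> S b -> lang S p -> le_of lt a b -> Prov (Imp (Box a p) (Box b p)).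
Proof. intros; apply GLP_ax; [simpl; tauto|now constructor]. Qed.

Lemma prov_Box4 a b p :
  S a -> S b -> lang S p -> le_of lt a b -> Prov (Imp (Box a p) (Box b (Box a p))).
Proof. intros; apply GLP_ax; [simpl; tauto|now constructor]. Qed.

Lemma prov_Box_Box a b p :
  S a -> S b -> lang S p -> le_of lt a b -> Prov (Imp (Box a p) (Box a (Box b p))).
Proof.
  intros; apply prov_trans with (Box a (Box a p)).
  - apply prov_Box4; auto. now right.
  - apply prov_Box_mono; auto. now apply prov_mono.
Qed.

(** [ax_dia] speaks of a box over a negation; the double negations are cleared under the boxes. *)
Lemma prov_negBox a b p :
  S a -> S b -> lang S p -> lt a b ->
  Prov (Imp (Neg (Box a p)) (Box b (Neg (Box a p)))).
Proof.
  intros Ha Hb Hp Hab.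
  assert (H1 : Prov (Imp p (Neg (Neg p)))).
  { apply prov_taut; [simpl; tauto|].
    intros v; rewrite bval_Imp; simpl; now destruct (bval v p). }
  assert (H2 : Prov (Imp (Neg (Neg p)) p)).
  { apply prov_taut; [simpl; tauto|].
    intros v; rewrite bval_Imp; simpl; now destruct (bval v p). }
  assert (Hneg : forall q r, Prov (Imp q r) -> Prov (Imp (Neg r) (Neg q))).
  { intros q r H; pose proof (prov_lang _ H).
    apply (prov_cons _ _) with (2 := H); [simpl in *; tauto|].
    intros v; rewrite !bval_Imp; simpl; now destruct (bval v q), (bval v r). }
  apply prov_trans with (Dia a (Neg p)).
  - apply Hneg, prov_Box_mono; auto.
  - apply prov_trans with (Box b (Dia a (Neg p))).
    + apply GLP_ax; [simpl; tauto|now constructor].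
    + apply prov_Box_mono; auto. apply Hneg, prov_Box_mono; auto.
Qed.

(** * Consistent diagrams and worlds *)

Definition lit (x : form M -> bool) (p : form M) : form M :=
  if x p then p else Neg p.

Lemma bval_lit v x p : bval v (lit x p) = true <-> bval v p = x p.
Proof.
  unfold lit; destruct (x p); simpl; [easy|]. apply negb_true_iff.
Qed.

Lemma lang_lit x p : lang S p -> lang S (lit x p).
Proof. unfold lit; now destruct (x p). Qed.

(** The formulas of [D] are decided in turn, each with a sign that keeps the conjunction
    consistent. *)
Lemma lindenbaum (D : list (form M)) (c : form M) :
  (forall p, In p D -> lang S p) -> lang S c -> ~ Prov (Neg c) ->
  exists x, ~ Prov (Neg (And c (conj (map (lit x) D)))).
Proof.
  revert c; induction D as [|d D IH]; intros c HD Hc Hcons.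
  { exists (fun _ => true); intros H; apply Hcons.
    apply (prov_cons _ _) with (2 := H); [auto|].
    intros v; simpl; now rewrite andb_true_r. }
  assert (Hd : lang S d) by (apply HD; simpl; auto).
  assert (HD' : forall p, In p D -> lang S p) by (intros; apply HD; simpl; auto).
  assert (Hb : exists b, ~ Prov (Neg (And c (lit (fun _ => b) d)))).
  { apply NNPP; intros Hno; apply Hcons.
    assert (H : forall b, Prov (Neg (And c (lit (fun _ => b) d)))).
    { intros b; apply NNPP; intros H; apply Hno; eauto. }
    apply (prov_cons2 _ _ _) with (2 := H true) (3 := H false); [auto|].
    intros v; unfold lit; simpl; destruct (bval v c), (bval v d); simpl; auto. }
  destruct Hb as [b Hb].
  apply IH in Hb; auto; [|simpl; split; auto; now apply lang_lit].
  destruct Hb as [x Hx].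
  (* [x] comes from the rest of [D] and need not give [d] the chosen sign, hence the override. *)
  exists (fun e => if decb (e = d) then b else x e).
  intros H; apply Hx; apply (prov_cons _ _) with (2 := H).
  - simpl; split; [split; auto; now apply lang_lit|].
    apply lang_conj; intros p; rewrite in_map_iff; intros [e [<- He]].
    apply lang_lit; auto.
  - intros v; simpl; rewrite !negb_true_iff, <- !not_true_iff_false, !andb_true_iff.
    rewrite !bval_conj, !bval_lit, (proj2 (decbP (d = d)) eq_refl).
    intros Hn [[Hvc Hvb] Hvx]; apply Hn; repeat split; auto.
    intros p; rewrite in_map_iff; intros [e [<- He]]; apply bval_lit.
    destruct (decb (e = d)) eqn:E.
    + rewrite decbP in E; now subst.
    + apply bval_lit, Hvx, in_map, He.
Qed.

Variable phi : form M.
Hypothesis Hphi : lang S phi.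

(* Closing the boxed subformulas under change of modality lets worlds express
   that [Box a q] is inherited by [Box b q] for [b] above [a]. *)
Definition adequate : list (form M) :=
  subforms phi ++
  flat_map (fun q => map (fun a => Box a q) (mods phi)) (bodies phi).

Lemma adequate_Box a q :
  In a (mods phi) -> In q (bodies phi) -> In (Box a q) adequate.
Proof.
  intros Ha Hq; apply in_or_app; right; apply in_flat_map.
  exists q; split; auto. apply in_map_iff; eauto.
Qed.

Lemma bodies_adequate q : In q (bodies phi) -> In q adequate.
Proof.
  rewrite in_bodies; intros [a H]; apply in_or_app; left.
  eapply subforms_Box; eauto.
Qed.

Lemma lang_adequate p : In p adequate -> lang S p.
Proof.
  intros H; apply in_app_or in H; destruct H as [H|H].
  - eapply lang_subforms; eauto.
  - apply in_flat_map in H; destruct H as [q [Hq H]].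
    apply in_map_iff in H; destruct H as [a [<- Ha]]; split.
    + eapply lang_mods; eauto.
    + eapply lang_bodies; eauto.
Qed.

Definition diagram (x : form M -> bool) : form M := conj (map (lit x) adequate).

Lemma bval_diagram v x :
  bval v (diagram x) = true <-> forall p, In p adequate -> bval v p = x p.
Proof.
  unfold diagram; rewrite bval_conj; split.
  - intros H p Hp; apply bval_lit, H, in_map, Hp.
  - intros H p; rewrite in_map_iff; intros [q [<- Hq]]; apply bval_lit; auto.
Qed.

Lemma lang_diagram x : lang S (diagram x).
Proof.
  apply lang_conj; intros p; rewrite in_map_iff; intros [q [<- Hq]].
  apply lang_lit, lang_adequate, Hq.
Qed.

Definition world : Type := { x : form M -> bool | ~ Prov (Neg (diagram x)) }.

Definition holds (x : world) (p : form M) : bool := proj1_sig x p.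

(** Otherwise [p] would refute the diagram propositionally. The valuation also evaluates formulas
    outside [adequate]. *)
Lemma world_theorem (x : world) (p : form M) :
  Prov p -> exists v, (forall q, In q adequate -> bval v q = holds x q) /\
                 bval v p = true.
Proof.
  destruct x as [x Hx]; simpl; intros Hp; apply NNPP; intros Hno.
  apply Hx, (prov_cons p); auto; [apply lang_diagram|].
  intros v Hv; simpl; rewrite negb_true_iff, <- not_true_iff_false, bval_diagram.
  intros H; apply Hno; exists v; auto.
Qed.

Lemma world_Imp (x : world) (p q : form M) :
  In p adequate -> In q adequate -> Prov (Imp p q) ->
  holds x p = true -> holds x q = true.
Proof.
  intros Hp Hq H; destruct (world_theorem x _ H) as [v [Hv Hval]].
  rewrite bval_Imp, !Hv in Hval; auto. intros Hx; now rewrite Hx in Hval.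
Qed.

Lemma diagram_holds (x : world) (p : form M) :
  In p adequate -> Prov (Imp (diagram (holds x)) p) -> holds x p = true.
Proof.
  intros Hp H; destruct (world_theorem x _ H) as [v [Hv Hval]].
  rewrite bval_Imp, (proj2 (bval_diagram v (holds x)) Hv), Hv in Hval; auto.
Qed.

Lemma prov_diagram_lit (x : form M -> bool) (p : form M) :
  In p adequate -> Prov (Imp (diagram x) (lit x p)).
Proof.
  intros Hp; apply prov_taut.
  - split; [apply lang_diagram|apply lang_lit, lang_adequate, Hp].
  - intros v; rewrite bval_Imp; destruct (bval v (diagram x)) eqn:E; auto.
    apply bval_lit; rewrite bval_diagram in E; auto.
Qed.

(** The canonical relation for J. Passing [Box b q] on for all [b] from [a] upward gives
    [arrow_mix], agreement on lower boxes gives [arrow_low], and the box gained in the last clause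
    gives well-foundedness. The first clause empties the relations of modalities foreign to
    [phi]. *)
Definition arrow (a : M) (x y : world) : Prop :=
  In a (mods phi) /\
  (forall q, In q (bodies phi) -> holds x (Box a q) = true ->
     holds y q = true /\
     forall b, In b (mods phi) -> le_of lt a b -> holds y (Box b q) = true) /\
  (forall q b, In q (bodies phi) -> In b (mods phi) -> lt b a ->
     holds y (Box b q) = holds x (Box b q)) /\
  exists q, In q (bodies phi) /\ holds y (Box a q) = true /\ holds x (Box a q) = false.

(** Along an arrow no [Box a q] is lost and one is gained, so fewer are false. *)
Lemma arrow_wf a : well_founded (fun y x => arrow a x y).
Proof.
  apply (wf_incl _ _ (ltof _ (fun x =>
    length (filter (fun q => negb (holds x (Box a q))) (bodies phi))))).
  2: apply well_founded_ltof.
  intros y x [Ha [Hup [_ [q [Hq [Hy Hx]]]]]]; unfold ltof.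
  assert (Hincl : forall r, In r (bodies phi) ->
            holds y (Box a r) = false -> holds x (Box a r) = false).
  { intros r Hr Hr'; apply not_true_iff_false; intros Hx'.
    destruct (Hup r Hr Hx') as [_ H]; rewrite H in Hr'; auto; [easy|now right]. }
  clear Hup; revert Hq Hincl; induction (bodies phi) as [|r l IH]; [easy|].
  intros Hq Hincl; simpl.
  assert (Hle : length (filter (fun q => negb (holds y (Box a q))) l) <=
                length (filter (fun q => negb (holds x (Box a q))) l)).
  { assert (Hincl' : forall r, In r l ->
      holds y (Box a r) = false -> holds x (Box a r) = false)
      by (intros; apply Hincl; simpl; auto).
    clear - Hincl'; induction l as [|e l IHl]; simpl; auto.
    assert (length (filter (fun q => negb (holds y (Box a q))) l) <=
            length (filter (fun q => negb (holds x (Box a q))) l))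
      by (apply IHl; intros; apply Hincl'; simpl; auto).
    specialize (Hincl' e (or_introl eq_refl)).
    destruct (holds y (Box a e)); simpl.
    - destruct (holds x (Box a e)); simpl; lia.
    - rewrite Hincl'; simpl; auto; lia. }
  destruct Hq as [->|Hq].
  - rewrite Hy, Hx; simpl; lia.
  - assert (Hlt := IH Hq (fun r Hr => Hincl r (or_intror Hr))).
    specialize (Hincl r (or_introl eq_refl)).
    destruct (holds y (Box a r)); simpl.
    + destruct (holds x (Box a r)); simpl; lia.
    + rewrite Hincl; simpl; auto; lia.
Qed.

#[local] Instance lt_strict_order : StrictOrder lt := proj1 Hlin.

Lemma arrow_trans a x y z : arrow a x y -> arrow a y z -> arrow a x z.
Proof.
  intros [Ha [H1 [H2 [q [Hq [Hqy Hqx]]]]]] [_ [H3 [H4 _]]]; split; auto.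
  split; [|split].
  - intros r Hr Hx; apply H3; auto. apply H1; auto. now right.
  - intros r b Hr Hb Hlt; rewrite H4; auto.
  - exists q; repeat split; auto. apply (H3 q Hq Hqy); auto. now right.
Qed.

Lemma arrow_low a b x y z : lt a b -> arrow b x y -> (arrow a x z <-> arrow a y z).
Proof.
  intros Hab [_ [_ [H _]]].
  assert (Heq : forall q c, In q (bodies phi) -> In c (mods phi) -> le_of lt c a ->
            holds y (Box c q) = holds x (Box c q)).
  { intros q c Hq Hc [Hca| ->]; apply H; auto. transitivity a; auto. }
  split; intros [Ha [H1 [H2 [q [Hq [Hqz Hq']]]]]]; split; auto;
    (split; [|split]).
  - intros r Hr; rewrite Heq; auto. now right.
  - intros r c Hr Hc Hca; rewrite Heq; auto. now left.
  - exists q; rewrite Heq; auto. now right.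
  - intros r Hr; rewrite <- Heq; auto. now right.
  - intros r c Hr Hc Hca; rewrite <- Heq; auto. now left.
  - exists q; rewrite <- Heq; auto. now right.
Qed.

Lemma arrow_mix a b x y z : lt a b -> arrow a x y -> arrow b y z -> arrow a x z.
Proof.
  intros Hab [Ha [H1 [H2 [q [Hq [Hqy Hqx]]]]]] [Hb [H3 [H4 _]]]; split; auto.
  split; [|split].
  - intros r Hr Hx; destruct (H1 r Hr Hx) as [_ Hy].
    destruct (H3 r Hr) as [Hz Hz']; [apply Hy; auto; now left|].
    split; auto; intros c Hc Hac.
    (* From [a] up to below [b] the boxes of [z] are those of [y]; from [b] on the second arrow
       passes them on. *)
    destruct (proj2 Hlin c b) as [Hcb|[->|Hbc]].
    + rewrite H4; auto.
    + apply Hz'; auto. now right.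
    + apply Hz'; auto. now left.
  - intros r c Hr Hc Hca; rewrite H4, H2; auto. transitivity a; auto.
  - exists q; rewrite H4; auto.
Qed.

Lemma holds_mono x a b q :
  In q (bodies phi) -> In a (mods phi) -> In b (mods phi) -> le_of lt a b ->
  holds x (Box a q) = true -> holds x (Box b q) = true.
Proof.
  intros Hq Ha Hb Hab; apply world_Imp; auto using adequate_Box.
  apply prov_mono; auto; try (apply (lang_mods S phi); assumption).
  apply (lang_bodies S phi); auto.
Qed.

(** A Loeb argument: if the demands of an arrow on [y] were inconsistent with [Box a q] and the
    negation of [q], boxing them would put [Box a q] into [x]. *)
Lemma arrow_exists x a q :
  In a (mods phi) -> In q (bodies phi) -> holds x (Box a q) = false ->
  exists y, arrow a x y /\ holds y q = false.
Proof.
  intros Ha Hq Hx.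
  assert (Sa : S a) by (apply (lang_mods S phi); auto).
  assert (Sq : lang S q) by (apply (lang_bodies S phi); auto).
  set (up := filter (fun b => decb (le_of lt a b)) (mods phi)).
  set (low := filter (fun b => decb (lt b a)) (mods phi)).
  assert (Hup : forall b, In b up <-> In b (mods phi) /\ le_of lt a b).
  { intros b; unfold up; now rewrite filter_In, decbP. }
  assert (Hlow : forall b, In b low <-> In b (mods phi) /\ lt b a).
  { intros b; unfold low; now rewrite filter_In, decbP. }
  set (G := flat_map (fun r =>
    (if holds x (Box a r) then r :: map (fun b => Box b r) up else []) ++
    map (fun b => lit (holds x) (Box b r)) low) (bodies phi)).
  (* Upper boxes come from [prov_Box_Box], lower ones from [prov_Box4] or, if false, from
     [prov_negBox]. *)
  assert (HG : forall g, In g G -> Prov (Imp (diagram (holds x)) (Box a g))).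
  { intros g Hg; apply in_flat_map in Hg; destruct Hg as [r [Hr Hg]].
    assert (Sr : lang S r) by (apply (lang_bodies S phi); auto).
    apply in_app_or in Hg; destruct Hg as [Hg|Hg].
    - pose proof (prov_diagram_lit (holds x) (Box a r) (adequate_Box a r Ha Hr)) as HB.
      unfold lit in HB; destruct (holds x (Box a r)); [|easy].
      destruct Hg as [<-|Hg]; auto.
      apply in_map_iff in Hg; destruct Hg as [b [<- Hb]]; apply Hup in Hb.
      destruct Hb as [Hb Hab]; apply (prov_trans _ _ _ HB).
      apply prov_Box_Box; auto. apply (lang_mods S phi); auto.
    - apply in_map_iff in Hg; destruct Hg as [b [<- Hb]]; apply Hlow in Hb.
      destruct Hb as [Hb Hba].
      assert (Sb : S b) by (apply (lang_mods S phi); auto).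
      pose proof (prov_diagram_lit (holds x) (Box b r) (adequate_Box b r Hb Hr)) as HB.
      unfold lit in *; destruct (holds x (Box b r)); apply (prov_trans _ _ _ HB).
      + apply prov_Box4; auto. now left.
      + apply prov_negBox; auto. }
  assert (SG : lang S (conj G)).
  { apply lang_conj; intros g Hg; apply HG, prov_lang in Hg; simpl in Hg; tauto. }
  set (c := And (conj G) (And (Box a q) (Neg q))).
  assert (Hc : ~ Prov (Neg c)).
  { intros H.
    assert (H1 : Prov (Imp (conj G) (Imp (Box a q) q))).
    { apply (prov_cons _ _) with (2 := H); [simpl; tauto|].
      intros v; rewrite !bval_Imp; unfold c; simpl.
      destruct (bval v (conj G)), (v (Box a q)), (bval v q); simpl; auto. }
    apply (prov_Box_conj a) in H1; auto.
    assert (H2 : Prov (Imp (diagram (holds x)) (conj (map (Box a) G)))).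
    { apply prov_conj; [apply lang_diagram|].
      intros p Hp; apply in_map_iff in Hp; destruct Hp as [g [<- Hg]]; auto. }
    assert (H3 : Prov (Imp (Box a (Imp (Box a q) q)) (Box a q))).
    { apply GLP_ax; [simpl; tauto|constructor]. }
    rewrite (diagram_holds x (Box a q)) in Hx; [easy|now apply adequate_Box|].
    eapply prov_trans; [exact H2|]. eapply prov_trans; eauto. }
  destruct (lindenbaum adequate c) as [y Hy]; auto using lang_adequate.
  { simpl; tauto. }
  assert (Hy' : ~ Prov (Neg (diagram y))).
  { intros H; apply Hy, (prov_cons _ _) with (2 := H).
    - split; [simpl; tauto|apply lang_diagram].
    - intros v; unfold diagram; simpl; rewrite !negb_true_iff.
      intros ->; apply andb_false_r. }
  assert (Hv : exists v, (forall p, In p adequate -> bval v p = y p) /\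
                 bval v c = true).
  { apply NNPP; intros Hno; apply Hy, prov_taut.
    - split; [simpl; tauto|apply lang_diagram].
    - intros v; change (negb (bval v c && bval v (diagram y)) = true).
      rewrite negb_true_iff, <- not_true_iff_false, andb_true_iff, bval_diagram.
      intros [H1 H2]; apply Hno; eauto. }
  destruct Hv as [v [Hv Hvc]].
  unfold c in Hvc; simpl in Hvc; rewrite !andb_true_iff, bval_conj, negb_true_iff in Hvc.
  destruct Hvc as [HvG [Hvq Hvnq]].
  assert (HyG : forall r, In r (bodies phi) -> forall g,
    In g ((if holds x (Box a r) then r :: map (fun b => Box b r) up else []) ++
          map (fun b => lit (holds x) (Box b r)) low) -> bval v g = true).
  { intros r Hr g Hg; apply HvG, in_flat_map; eauto. }
  exists (exist _ y Hy' : world); split.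
  - split; auto; split; [|split].
    + intros r Hr Hxr; specialize (HyG r Hr); rewrite Hxr in HyG; split.
      * unfold holds; simpl; rewrite <- Hv by now apply bodies_adequate.
        apply HyG; simpl; auto.
      * intros b Hb Hab; unfold holds; simpl; rewrite <- Hv by now apply adequate_Box.
        apply HyG, in_or_app; left; simpl; right.
        apply in_map_iff; exists b; split; auto. apply Hup; auto.
    + intros r b Hr Hb Hba; unfold holds at 1; simpl.
      rewrite <- Hv by now apply adequate_Box.
      apply bval_lit, (HyG r Hr), in_or_app; right.
      apply in_map_iff; exists b; split; auto. apply Hlow; auto.
    + exists q; split; auto; split; auto.
      unfold holds; simpl; rewrite <- Hv by now apply adequate_Box. auto.
  - unfold holds; simpl; rewrite <- Hv by now apply bodies_adequate. auto.
Qed.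

(** * Truth conditions in the canonical model *)

Lemma holds_Top x : In Top (subforms phi) -> holds x Top = true.
Proof.
  intros H; destruct (world_theorem x Top) as [v [Hv _]].
  - now apply prov_taut.
  - rewrite <- Hv; auto. now apply in_or_app; left.
Qed.

Lemma holds_Neg x q :
  In (Neg q) (subforms phi) -> holds x (Neg q) = negb (holds x q).
Proof.
  intros H; destruct (world_theorem x Top) as [v [Hv _]].
  - now apply prov_taut.
  - rewrite <- !Hv; auto; apply in_or_app; left; auto using subforms_Neg.
Qed.

Lemma holds_And x q r :
  In (And q r) (subforms phi) -> holds x (And q r) = holds x q && holds x r.
Proof.
  intros H; destruct (world_theorem x Top) as [v [Hv _]].
  - now apply prov_taut.
  - destruct (subforms_And phi q r H).
    rewrite <- !Hv; auto; apply in_or_app; left; auto.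
Qed.

Lemma holds_Box x a q :
  In (Box a q) (subforms phi) ->
  (holds x (Box a q) = true <-> forall y, arrow a x y -> holds y q = true).
Proof.
  intros H.
  assert (Ha : In a (mods phi)) by (eapply in_mods; eauto).
  assert (Hq : In q (bodies phi)) by (apply in_bodies; eauto).
  split.
  - intros Hx y [_ [Hup _]]; now apply Hup.
  - intros Hall; apply not_false_iff_true; intros Hx.
    destruct (arrow_exists x a q Ha Hq Hx) as [y [Hy Hyq]].
    rewrite Hall in Hyq; easy.
Qed.

Lemma refuting_world : ~ Prov phi -> exists x, holds x phi = false.
Proof.
  intros Hno.
  destruct (lindenbaum adequate (Neg phi)) as [x Hx]; auto using lang_adequate.
  { intros H; apply Hno, (prov_cons _ _) with (2 := H); auto.
    intros v; simpl; now rewrite negb_involutive. }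
  assert (Hx' : ~ Prov (Neg (diagram x))).
  { intros H; apply Hx, (prov_cons _ _) with (2 := H).
    - split; [auto|apply lang_diagram].
    - intros v; unfold diagram; simpl; rewrite !negb_true_iff.
      intros ->; apply andb_false_r. }
  exists (exist _ x Hx' : world); apply not_true_iff_false; intros Hphi'.
  unfold holds in Hphi'; simpl in Hphi'.
  apply Hx, prov_taut; [split; [auto|apply lang_diagram]|].
  intros v; change (negb (negb (bval v phi) && bval v (diagram x)) = true).
  rewrite negb_true_iff, <- not_true_iff_false, andb_true_iff, bval_diagram.
  intros [H1 H2]; rewrite H2, Hphi' in H1; [easy|].
  apply in_or_app; left; apply subforms_refl.
Qed.

End Canonical.

(** * Conservativity over the sublanguage *)

Lemma GLP_within_GLP (M : Type) (lt : M -> M -> Prop) (P : form M -> Prop) (p : form M) :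
  GLP_within lt P p -> GLP lt p.
Proof.
  unfold GLP; induction 1.
  - now apply GLP_ax.
  - now apply GLP_mp with p.
  - now apply GLP_nec.
Qed.

Theorem mainTheorem1 (Lambda : Type) (lt : Lambda -> Lambda -> Prop)
  (Hlin : strict_linear_order lt) (S : Lambda -> Prop)
  (phi : form Lambda) (Hphi : lang S phi) :
  GLP lt phi <-> GLP_sub lt S phi.
Proof.
  split; [|apply GLP_within_GLP].
  intros Hglp; apply NNPP; intros Hno.
  destruct (refuting_world _ lt S phi Hphi Hno) as [r Hr].
  set (lab := fun x p => holds _ lt S phi x p = true).
  set (val := fun x n => lab x (Var n)).
  pose proof (arrow_wf _ lt S phi) as R_wf.
  pose proof (arrow_trans _ lt S phi) as R_trans.
  pose proof (arrow_low _ lt Hlin S phi) as R_low.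
  pose proof (arrow_mix _ lt Hlin S phi) as R_mix.
  (* The canonical relations satisfy the frame conditions for all of [Lambda], so the derivation can
     be evaluated in an unfolding. *)
  destruct (GLP_sound _ lt Hlin _ _ val R_wf R_trans phi Hglp) as [L0 [X0 Hsound]].
  (* Adding bodies once suffices, since bodies of bodies are again bodies. *)
  set (X := X0 ++ flat_map bodies X0).
  set (L := L0 ++ mods phi).
  assert (HX : forall p, In p X -> incl (bodies p) X).
  { intros p Hp q Hq; apply in_or_app; right; apply in_flat_map.
    apply in_app_or in Hp; destruct Hp as [Hp|Hp]; eauto.
    apply in_flat_map in Hp; destruct Hp as [p0 [Hp0 Hp]].
    exists p0; split; auto.
    apply in_bodies in Hp; destruct Hp as [a Ha].
    apply (bodies_subforms p0 p); auto. eapply subforms_Box; eauto. }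
  (* [le_n] sets [N] to [length X + 1], the least value that [stabilization] admits. *)
  pose proof (root_good _ lt Hlin _ _ val R_wf L X _ HX (le_n _) r) as Hgood.
  pose proof (Hsound L X _ (incl_appl _ (incl_refl _)) (incl_appl _ (incl_refl _))
    _ Hgood) as Hforce.
  apply (force_lab _ lt Hlin _ _ val R_wf R_trans R_low R_mix L X _ HX (le_n _) phi lab)
    in Hforce; unfold lab in *; auto using subforms_refl.
  - simpl in Hforce; congruence.
  - reflexivity.
  - intros x; now apply holds_Top.
  - intros x q Hq; rewrite holds_Neg; auto.
    now rewrite negb_true_iff, not_true_iff_false.
  - intros x q q' Hq; rewrite holds_And; auto. apply andb_true_iff.
  - intros x a q Hq; now apply holds_Box.
  - intros x y a b q Hq Hab Hx HR.
    pose proof HR as [Hb [Hup _]]; apply Hup.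
    + apply in_bodies; eauto.
    + apply (holds_mono _ lt S phi Hphi x a b); auto.
      * apply in_bodies; eauto.
      * eapply in_mods; eauto.
      * now left.
  - apply incl_appr, incl_refl.
Qed.
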